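(* Let $A\in\mathbb{R}^{n\times n}$ be stable (all eigenvalues have negative real part), $b\in\mathbb{R}^{n\times1}$, let $Q=Q^T\in\mathbb{R}^{n\times n}$ be a user-selected positive definite matrix, and let $P=P^T\in\mathbb{R}^{n\times n}$ be the positive definite matrix that solves $A^TP+PA=-Q$. Let $\gamma,\beta,\mu>0$ be scalar design parameters, $\theta^*\in\mathbb{R}^N$ an unknown constant parameter, and $\phi(t)\in\mathbb{R}^N$, $t\ge t_0$, a time-varying feature. Put $\tilde\theta(t)=\theta(t)-\theta^*$ and $\mathcal{N}_t=1+\mu\,\phi(t)^T\phi(t)$, and consider the higher order algorithm $$\dot\vartheta=-\gamma\,\phi\, e^TPb,\qquad \dot\theta=-\beta(\theta-\vartheta)\,\mathcal{N}_t$$ for $(\vartheta(t),\theta(t))\in\mathbb{R}^N\times\mathbb{R}^N$, applied to the error model $$\dot e=Ae+b\,\tilde\theta^T\phi,\qquad e(t)\in\mathbb{R}^n,$$ with arbitrary initial condition. Then $$V=\frac1\gamma\|\vartheta-\theta^*\|^2+\frac1\gamma\|\theta-\vartheta\|^2+e^TPe$$ is a Lyapunov function with time derivative $$\dot V\le-\frac{2\beta}{\gamma}\|\theta-\vartheta\|^2-\|e\|^2-\bigl[\|e\|-2\|Pb\|\,\|\theta-\vartheta\|\,\|\phi\|\bigr]^2\le0,$$ and therefore $e\in\mathcal{L}_\infty$, $(\vartheta-\theta^* )\in\mathcal{L}_\infty$ and $(\theta-\vartheta)\in\mathcal{L}_\infty$. If in addition it is assumed that $\phi\in\mathcal{L}_\infty$,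 then $\lim_{t\to\infty}e(t)=0$. Also, if $\dot\phi\in\mathcal{L}_\infty$, then $$\lim_{t\to\infty}(\theta(t)-\vartheta(t))=0,\quad \lim_{t\to\infty}\dot\vartheta(t)=0,\quad \lim_{t\to\infty}\dot{\tilde\theta}(t)=0.$$
   Context: Model reference adaptive control and identification: the plant is $\dot x=Ax+b(u+\theta^{*T}\phi)$ with measurable state $x(t)\in\mathbb{R}^n$, scalar input $u(t)$, known stable $A$ and known $b$, unknown constant parameter $\theta^*\in\mathbb{R}^N$, and feature $\phi(t)\in\mathbb{R}^N$ (which may be a function of the state, $\phi(t)=\phi(x(t))$). The state estimator is $\dot{\hat x}=A\hat x+b(u+\theta^T\phi)$, where $\theta(t)\in\mathbb{R}^N$ is the parameter estimate. With $e=\hat x-x$ and $\tilde\theta=\theta-\theta^*$, the error model is $\dot e=Ae+b\tilde\theta^T\phi$. The higher order algorithm is the pair of differential equations for $(\vartheta,\theta)$ in the claim, with scalar design parameters $\gamma,\beta>0$ and normalizing signal $\mathcal{N}_t$ containing a scalar $\mu>0$. Conventions: $\|\cdot\|$ is the 2-norm. A function $f$ of time is in $\mathcal{L}_\infty$ if $\sup_t\|f(t)\|<\infty$ over the time interval considered. The condition $\dot\phi\in\mathcal{L}_\infty$ in the last sentence of the claim is imposed in addition to $\phi\in\mathcal{L}_\infty$. ''Lyapunov function'' means that $V$, as a function of the state $z=(e,\vartheta-\theta^*,\theta-\vartheta)$, is positive definite and decrescent (there are continuous non-decreasing scalar functions $\underline\alpha,\underline\beta$ vanishing at $0$ with $0<\underline\alpha(\|z\|)\le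 V\le\underline\beta(\|z\|)$ for $z\ne0$, and $V=0$ at $z=0$), and that its time derivative along solutions satisfies $\dot V\le0$.
   Formalization: The formal theorem additionally assumes Q ≥ 2I and μ ≥ 2γ‖Pb‖²/β; for arbitrary positive definite Q and μ > 0 the displayed bound on the derivative of V fails (e.g. A = -1, Q = 1, P = 1/2, θ = ϑ, e ≠ 0). *)

(* Defs.v *)
From mathcomp Require Export all_boot all_order all_algebra.
From mathcomp Require Export complex.
From mathcomp Require Export all_classical all_reals all_analysis.
Export Order.TTheory GRing.Theory Num.Theory.
Export numFieldNormedType.Exports.

Set Implicit Arguments.
Unset Strict Implicit.
Unset Printing Implicit Defensive.

Local Open Scope classical_set_scope.
Local Open Scope ring_scope.

Section LinearAlgebra.
Variable R : realType.

Definition dotv k (u v : 'cV[R]_k) : R := (u^T *m v) 0 0.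

(* The 2-norm; the library norm `|v| on matrices is the max norm.  Both induce
   the same topology, so limits and derivatives below are the library's. *)
Definition norm2 k (v : 'cV[R]_k) : R := Num.sqrt (dotv v v).

Definition quadform k (M : 'M[R]_k) (v : 'cV[R]_k) : R := dotv v (M *m v).

Definition sym_posdef k (M : 'M[R]_k) : Prop :=
  M^T = M /\ forall v : 'cV[R]_k, v != 0 -> 0 < quadform M v.

(* Loewner order M1 <= M2 *)
Definition loewner_le k (M1 M2 : 'M[R]_k) : Prop :=
  forall v : 'cV[R]_k, 0 <= quadform (M2 - M1) v.

Definition stable_mx k (A : 'M[R]_k) : Prop :=
  forall l : complex R,
    eigenvalue (map_mx (real_complex R) A) l -> complex.Re l < 0.

End LinearAlgebra.

Section Signals.
Variable R : realType.

Definition Linfty (t0 : R) k (f : R -> 'cV[R]_k) : Prop :=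
  exists M : R, forall t, t0 <= t -> norm2 (f t) <= M.

End Signals.

Section Lyapunov.
Variable R : realType.

Definition comparison_fun (a : R -> R) : Prop :=
  [/\ {within [set s | 0 <= s], continuous a},
      forall s r, 0 <= s -> s <= r -> a s <= a r
    & a 0 = 0].

Definition posdef_decrescent k (V : 'cV[R]_k -> R) : Prop :=
  V 0 = 0 /\
  exists al be : R -> R,
    [/\ comparison_fun al, comparison_fun be
      & forall z, z != 0 ->
          [/\ 0 < al (norm2 z), al (norm2 z) <= V z & V z <= be (norm2 z)]].

Definition lyapunov_function k (t0 : R) (sols : set (R -> 'cV[R]_k))
    (V : 'cV[R]_k -> R) : Prop :=
  posdef_decrescent V /\
  forall z, sols z -> forall t, t0 <= t ->
    derivable (V \o z) t 1 /\ derive1 (V \o z) t <= 0.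

End Lyapunov.

Section HigherOrderTuner.
Variables (R : realType) (n N : nat).

Definition normalizer (mu : R) (phi : R -> 'cV[R]_N) (t : R) : R :=
  1 + mu * dotv (phi t) (phi t).

(* Classical solutions on [t0, +oo[.  Signals are total functions of time
   whose values before t0 are irrelevant.  The two-sided derivative at t0 is no
   restriction: a signal on [t0, +oo[ with a right derivative at t0 extends
   affinely to the left of t0. *)
Definition hot_solution (A : 'M[R]_n) (b : 'cV[R]_n) (P : 'M[R]_n)
    (gamma beta mu : R) (thetas : 'cV[R]_N) (phi : R -> 'cV[R]_N) (t0 : R)
    (e : R -> 'cV[R]_n) (vtheta theta : R -> 'cV[R]_N) : Prop :=
  forall t, t0 <= t ->
  [/\ is_derive t (1 : R) e (A *m e t + dotv (theta t - thetas) (phi t) *: b),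
      is_derive t (1 : R) vtheta
        (- (gamma * dotv (e t) (P *m b)) *: phi t)
    & is_derive t (1 : R) theta
        (- (beta * normalizer mu phi t) *: (theta t - vtheta t))].

Definition error_state (thetas : 'cV[R]_N)
    (e : R -> 'cV[R]_n) (vtheta theta : R -> 'cV[R]_N) (t : R)
    : 'cV[R]_(n + (N + N)) :=
  col_mx (e t) (col_mx (vtheta t - thetas) (theta t - vtheta t)).

Definition error_trajectories (A : 'M[R]_n) (b : 'cV[R]_n) (P : 'M[R]_n)
    (gamma beta mu : R) (thetas : 'cV[R]_N) (phi : R -> 'cV[R]_N) (t0 : R)
    : set (R -> 'cV[R]_(n + (N + N))) :=
  [set z | exists e vtheta theta,
     hot_solution A b P gamma beta mu thetas phi t0 e vtheta theta /\
     z = error_state thetas e vtheta theta].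

Definition hot_V (gamma : R) (P : 'M[R]_n) (z : 'cV[R]_(n + (N + N))) : R :=
  gamma^-1 * norm2 (usubmx (dsubmx z)) ^+ 2
  + gamma^-1 * norm2 (dsubmx (dsubmx z)) ^+ 2
  + quadform P (usubmx z).

(* How the user-selected Q and the normalization gain mu must be chosen for the
   standard bound on the derivative of hot_V.  For arbitrary initial states and
   features the choice is forced: at a state with theta = vtheta the bound
   reads e^T Q e >= 2 |e|^2, and at a state with e = 0 it reads
   mu * beta >= 2 * gamma * |P b|^2. *)
Definition design_condition (b : 'cV[R]_n) (P Q : 'M[R]_n)
    (gamma beta mu : R) : Prop :=
  loewner_le (2%:M) Q /\ 2 * gamma * norm2 (P *m b) ^+ 2 / beta <= mu.

End HigherOrderTuner.

(* Main.v *)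
(* With x = vtheta - theta*, y = theta - vtheta and the Lyapunov equation, the
   terms in x . phi cancel and along solutions
     V' = - (2 beta / gamma) N_t |y|^2 + 4 (e . P b) (y . phi) - e . Q e.
   The gain mu makes the normalizer dominate 4 |P b|^2 |y|^2 |phi|^2, which
   together with Q >= 2 completes the square.  For bounded phi, |e|^2 and |y|^2
   have bounded derivatives and are dissipated by V, so both tend to 0 by
   Barbalat's lemma; the derivatives of vtheta and theta are bounded multiples
   of e and y. *)
Require Import Defs.
From mathcomp Require Import ring lra.

Set Implicit Arguments.
Unset Strict Implicit.
Unset Printing Implicit Defensive.

Local Open Scope classical_set_scope.
Local Open Scope ring_scope.

(** * Euclidean inner product and positive definite forms *)

Section EuclideanProduct.
Variables (R : realType) (k : nat).
Implicit Types (u v w : 'cV[R]_k) (M P : 'M[R]_k).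

Lemma dotvE u v : dotv u v = \sum_i u i 0 * v i 0.
Proof. by rewrite /dotv mxE; apply: eq_bigr => i _; rewrite !mxE. Qed.

Lemma dotvC u v : dotv u v = dotv v u.
Proof. by rewrite !dotvE; apply: eq_bigr => i _; rewrite mulrC. Qed.

Lemma dotvDr u v w : dotv u (v + w) = dotv u v + dotv u w.
Proof. by rewrite /dotv mulmxDr mxE. Qed.

Lemma dotvDl u v w : dotv (u + v) w = dotv u w + dotv v w.
Proof. by rewrite dotvC dotvDr !(dotvC w). Qed.

Lemma dotvZr a u v : dotv u (a *: v) = a * dotv u v.
Proof. by rewrite /dotv -scalemxAr mxE. Qed.

Lemma dotvZl a u v : dotv (a *: u) v = a * dotv u v.
Proof. by rewrite dotvC dotvZr dotvC. Qed.

Lemma dotvNr u v : dotv u (- v) = - dotv u v.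
Proof. by rewrite -scaleN1r dotvZr mulN1r. Qed.

Lemma dotvNl u v : dotv (- u) v = - dotv u v.
Proof. by rewrite dotvC dotvNr dotvC. Qed.

Lemma dotv_mulmxl M u v : dotv (M *m u) v = dotv u (M^T *m v).
Proof. by rewrite /dotv trmx_mul mulmxA. Qed.

Lemma dotv_ge0 v : 0 <= dotv v v.
Proof. by rewrite dotvE sumr_ge0// => i _; rewrite -expr2 sqr_ge0. Qed.

Lemma sqr_entry_le_dotv v i : v i 0 ^+ 2 <= dotv v v.
Proof.
rewrite dotvE (bigD1 i)//= -expr2 lerDl sumr_ge0// => j _.
by rewrite -expr2 sqr_ge0.
Qed.

Lemma dotv_gt0 v : v != 0 -> 0 < dotv v v.
Proof.
move=> v0; rewrite lt_def dotv_ge0 andbT; apply: contra v0 => /eqP vv0.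
apply/eqP/matrixP => i j; rewrite ord1 mxE; apply/eqP.
by rewrite -sqrf_eq0 eq_le sqr_ge0 andbT -vv0 sqr_entry_le_dotv.
Qed.

Lemma norm2_ge0 v : 0 <= norm2 v. Proof. exact: sqrtr_ge0. Qed.

Lemma sqr_norm2 v : norm2 v ^+ 2 = dotv v v.
Proof. by rewrite sqr_sqrtr// dotv_ge0. Qed.

Lemma entry_le_norm2 v i : `|v i 0| <= norm2 v.
Proof.
by rewrite -sqrtr_sqr ler_sqrt ?dotv_ge0 ?sqr_entry_le_dotv.
Qed.

Lemma quadform_sym M u v : M^T = M -> dotv u (M *m v) = dotv v (M *m u).
Proof. by move=> sM; rewrite dotvC dotv_mulmxl sM. Qed.

Lemma sym_posdef1 : sym_posdef (1%:M : 'M[R]_k).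
Proof.
by split=> [|v v0]; rewrite ?trmx1// /quadform mul1mx dotv_gt0.
Qed.

(** With [q] the form of [P], the value of [q] at [q u *: v - (u.Pv) *: u] is nonnegative and equals
    [q u * (q u * q v - (u.Pv)^2)]; for [u != 0] the factor [q u] cancels. The case where this
    vector is 0 is separate because definiteness speaks of nonzero vectors only. *)
Lemma posdef_CauchySchwarz P u v : sym_posdef P ->
  dotv u (P *m v) ^+ 2 <= quadform P u * quadform P v.
Proof.
move=> [sP pP]; have [->|u0] := eqVneq u 0.
  by rewrite /quadform /dotv trmx0 !mul0mx mxE expr0n mul0r.
have a0 := pP _ u0.
have : 0 <= quadform P (quadform P u *: v - dotv u (P *m v) *: u).
  have [->|w0] := eqVneq (quadform P u *: v - dotv u (P *m v) *: u) 0.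
    by rewrite /quadform /dotv trmx0 mul0mx mxE.
  exact/ltW/pP.
have -> : quadform P (quadform P u *: v - dotv u (P *m v) *: u) =
    quadform P u * (quadform P u * quadform P v - dotv u (P *m v) ^+ 2).
  rewrite [LHS]/quadform mulmxBr -!scalemxAr
    !(dotvDl, dotvDr, dotvNl, dotvNr, dotvZl, dotvZr).
  by rewrite (quadform_sym v u sP) /quadform; ring.
by rewrite pmulr_rge0// subr_ge0.
Qed.

(** The case [P = 1] of the weighted inequality, compared through squares. *)
Lemma CauchySchwarz u v : `|dotv u v| <= norm2 u * norm2 v.
Proof.
rewrite -ler_sqr ?nnegrE ?mulr_ge0 ?norm2_ge0// exprMn !sqr_norm2.
rewrite real_normK ?num_real//.
have := posdef_CauchySchwarz u v sym_posdef1.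
by rewrite /quadform !mul1mx.
Qed.

Lemma quadform_bounded M : exists2 K, 0 < K &
  forall v, `|quadform M v| <= K * dotv v v.
Proof.
(* The entries of [v] are at most [norm2 v], so the sum of the [|M i j|] already bounds the form;
   the extra 1 keeps the constant positive when [M = 0]. *)
exists (1 + \sum_i \sum_j `|M i j|).
  by rewrite ltr_pwDl// sumr_ge0// => i _; rewrite sumr_ge0.
move=> v; rewrite mulrDl mul1r ler_wpDl ?dotv_ge0// /quadform dotvE mulr_suml.
apply: le_trans (ler_norm_sum _ _ _) _; apply: ler_sum => i _.
rewrite mxE mulr_sumr mulr_suml.
apply: le_trans (ler_norm_sum _ _ _) _; apply: ler_sum => j _.
rewrite mulrCA normrM ler_wpM2l// -sqr_norm2 expr2 normrM.
by rewrite ler_pM// entry_le_norm2.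
Qed.

(** A row [w] of the left kernel satisfies [w P w^T = 0], so definiteness forces [w = 0]. *)
Lemma sym_posdef_unitmx P : sym_posdef P -> P \in unitmx.
Proof.
move=> [sP pP]; rewrite -row_free_unit -kermx_eq0; apply/eqP/row_matrixP => i.
rewrite row0; apply/eqP; rewrite -[_ == 0]negbK; apply/negP => w0.
have wP : row i (kermx P) *m P = 0 by rewrite -row_mul mulmx_ker row0.
have : 0 < quadform P (row i (kermx P))^T.
  by apply: pP; rewrite -trmx0 (inj_eq trmx_inj).
by rewrite /quadform /dotv trmxK mulmxA wP mul0mx mxE ltxx.
Qed.

(* Cauchy-Schwarz for P applied to v and P^-1 v gives
   (v.v)^2 <= (v.Pv)(v.P^-1 v), which replaces compactness of the sphere. *)
Lemma sym_posdef_coercive P : sym_posdef P -> exists2 c, 0 < c &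
  forall v, c * dotv v v <= quadform P v.
Proof.
move=> pP; have Pu := sym_posdef_unitmx pP.
have [K K0 hK] := quadform_bounded (invmx P).
(* [K] bounds the form of [P^-1]: replacing [v.P^-1 v] by [K (v.v)] and cancelling one factor [v.v]
   leaves the constant [K^-1]. *)
exists K^-1 => [|v]; first by rewrite invr_gt0.
rewrite ler_pdivrMl//.
have [->|v0] := eqVneq v 0.
  by rewrite /quadform /dotv trmx0 !mul0mx mxE mulr0.
have vv0 := dotv_gt0 v0.
have := posdef_CauchySchwarz v (invmx P *m v) pP.
rewrite {2}/quadform mulKVmx// (dotvC _ v) -/(quadform (invmx P) v) => h.
rewrite -(ler_pM2r vv0) -expr2; apply: le_trans h _.
rewrite [leRHS]mulrAC [leRHS]mulrC ler_wpM2l//; first exact/ltW/pP.2.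
by apply: le_trans (hK v); rewrite ler_norm.
Qed.

End EuclideanProduct.

Lemma dotv_col_mx (R : realType) (m n : nat) (u u' : 'cV[R]_m) (v v' : 'cV[R]_n) :
  dotv (col_mx u v) (col_mx u' v') = dotv u u' + dotv v v'.
Proof. by rewrite /dotv tr_col_mx mul_row_col mxE. Qed.

(** * Derivatives of vector signals, monotonicity and convergence to 0 *)

Section Derivatives.
Variable R : realType.

Lemma is_derive_mxP (V : normedModType R) m n (F : V -> 'M[R]_(m, n))
    (dF : 'M[R]_(m, n)) (t v : V) :
  is_derive t v F dF <->
  forall i j, is_derive t v (fun x => F x i j) (dF i j).
Proof.
split=> [[dvF dFE] i j|h].
  move/derivable_mxP/(_ i j): (dvF) => dvij; split=> //.
  by rewrite -dFE derive_mx// mxE.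
have dvF : derivable F t v by apply/derivable_mxP => i j; case: (h i j).
split=> //; rewrite derive_mx//; apply/matrixP => i j; rewrite mxE.
by case: (h i j).
Qed.

Lemma is_derive_mulmxl m n (M : 'M[R]_(m, n)) (f : R -> 'cV[R]_n) t df :
  is_derive t (1 : R) f df ->
  is_derive t (1 : R) (fun s => M *m f s) (M *m df).
Proof.
move=> /is_derive_mxP hf; apply/is_derive_mxP => i j.
have -> : (fun s => (M *m f s) i j) = \sum_k (fun s => M i k * f s k j).
  by apply/funext => s; rewrite mxE fct_sumE.
rewrite mxE; exact: is_derive_sum (fun k => is_deriveZ (M i k) (hf k j)).
Qed.

Lemma is_derive_dotv n (f g : R -> 'cV[R]_n) t df dg :
  is_derive t (1 : R) f df -> is_derive t (1 : R) g dg ->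
  is_derive t (1 : R) (fun s => dotv (f s) (g s)) (dotv df (g t) + dotv (f t) dg).
Proof.
move=> /is_derive_mxP hf /is_derive_mxP hg.
have -> : (fun s => dotv (f s) (g s)) = \sum_k (fun s => f s k 0 * g s k 0).
  by apply/funext => s; rewrite dotvE fct_sumE.
rewrite !dotvE -big_split/=; apply: is_derive_sum => k.
apply: is_derive_eq (is_deriveM (hf k 0) (hg k 0)) _.
by rewrite /GRing.scale/= addrC; congr (_ + _); exact: mulrC.
Qed.

(** Differentiability on the closed interval supplies the continuity that the mean value theorem
    asks for; placing [c] in the closed interval allows [a = b]. *)
Lemma is_derive_MVT (f df : R -> R) (a b : R) : a <= b ->
  (forall x : R, x \in `[a, b] -> is_derive x (1 : R) f (df x)) ->
  exists2 c, c \in `[a, b] & f b - f a = df c * (b - a).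
Proof.
move=> ab h; have dvf : {in `[a, b], forall x : R, derivable f x 1}.
  by move=> x /h[].
have cf := derivable_within_continuous dvf.
have dvf' x : x \in `]a, b[ -> is_derive x (1 : R) f (df x).
  move=> xab; apply: (h x); rewrite !in_itv/= in xab *.
  by case/andP: xab => /ltW-> /ltW->.
exact: (MVT_segment ab dvf' cf).
Qed.

Lemma derive_le0_nincr (V dV : R -> R) (t0 : R) :
  (forall t, t0 <= t -> is_derive t (1 : R) V (dV t)) ->
  (forall t, t0 <= t -> dV t <= 0) ->
  forall s t, t0 <= s -> s <= t -> V t <= V s.
Proof.
move=> hV hdV s t s0 st; have [|x xst e] := is_derive_MVT (f := V) (df := dV) st.
  by move=> x; rewrite in_itv/= => /andP[sx _]; apply: hV; lra.
rewrite in_itv/= in xst; case/andP: xst => sx xt.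
have x0 : t0 <= x by lra.
by rewrite -subr_le0 e mulr_le0_ge0 ?subr_ge0 ?hdV.
Qed.

(* Barbalat's lemma without integrals: if w t >= eps then w >= eps / 2 on
   [t, t + eps / 2L], over which V drops by a fixed amount; this cannot happen
   once V is close to its infimum. *)
Lemma dissipation_cvg0 (V dV w dw : R -> R) (t0 c L : R) :
  0 < c ->
  (forall t, t0 <= t -> is_derive t (1 : R) V (dV t)) ->
  (forall t, t0 <= t -> is_derive t (1 : R) w (dw t)) ->
  (forall t, t0 <= t -> 0 <= V t) ->
  (forall t, t0 <= t -> 0 <= w t) ->
  (forall t, t0 <= t -> dV t <= - (c * w t)) ->
  (forall t, t0 <= t -> `|dw t| <= L) ->
  w t @[t --> +oo] --> (0 : R).
Proof.
move=> c0 hV hw V0 w0 hdV hdw; apply/cvgr0Pnorm_lt => eps eps0.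
(* A strictly positive rate bound, so that the window length [h] can be obtained by division. *)
pose L' := 1 + `|L|; have L0 : 0 < L' by rewrite ltr_pwDl.
have {}hdw t : t0 <= t -> `|dw t| <= L'.
  by move=> /hdw h; apply: le_trans h _; rewrite (le_trans (ler_norm _))// lerDr.
have mono s t : t0 <= s -> s <= t -> V t <= V s.
  apply: (derive_le0_nincr hV) => x x0.
  by apply: le_trans (hdV _ x0) _; rewrite oppr_le0 mulr_ge0 ?w0// ltW.
pose h := eps / (2 * L'); have h0 : 0 < h by rewrite divr_gt0 ?mulr_gt0.
(* The least drop of [V] over a window of length [h] on which [w >= eps / 2]. *)
pose dl := c * (eps / 2) * h; have dl0 : 0 < dl.
  by apply: mulr_gt0 h0; rewrite mulr_gt0// divr_gt0.
pose S := V @` [set t | t0 <= t].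
have infS : has_inf S.
  split; first by exists (V t0); exists t0 => /=.
  by exists 0 => _ [t /= t0t <-]; exact: V0.
(* From [T] on, [V] lies less than [dl] above its infimum, hence has no room for a drop of [dl]. *)
have [_ [T /= T0 <-] VT] := inf_adherent dl0 infS.
exists T; split; first exact: num_real.
move=> t Tt; rewrite /= in Tt *.
have t0t : t0 <= t by lra.
rewrite ger0_norm ?w0// ltNge; apply/negP => wt.
(* Since [|dw| <= L'], [w] loses at most [L' * h = eps / 2] over the window. *)
have wh x : x \in `[t, t + h] -> eps / 2 <= w x.
  rewrite in_itv/= => /andP[tx xth].
  have [|y ytx e] := is_derive_MVT (f := w) (df := dw) tx.
    by move=> y; rewrite in_itv/= => /andP[ty _]; apply: hw; lra.
  rewrite in_itv/= in ytx; case/andP: ytx => ty yx.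
  have y0 : t0 <= y by lra.
  have /ler_normlP[hy _] := hdw _ y0.
  have : - (L' * h) <= dw y * (x - t).
    have : - dw y * (x - t) <= L' * (x - t) by apply: ler_wpM2r; lra.
    have : L' * (x - t) <= L' * h by apply: ler_wpM2l; lra.
    lra.
  have -> : L' * h = eps / 2 by rewrite /h; field; lra.
  lra.
have tth : t <= t + h by lra.
have [|x xth e] := is_derive_MVT (f := V) (df := dV) tth.
  by move=> x; rewrite in_itv/= => /andP[tx _]; apply: hV; lra.
have wx := wh _ xth; rewrite in_itv/= in xth; case/andP: xth => tx _.
have x0 : t0 <= x by lra.
have dVx := hdV _ x0.
have : dV x * h <= - (c * (eps / 2)) * h.
  by rewrite ler_pM2r// (le_trans dVx)// lerN2 ler_pM2l.
have eh : t + h - t = h by ring.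
rewrite eh in e; rewrite -e => drop.
have : inf S <= V (t + h) by apply: ge_inf infS.2 _ _; exists (t + h) => //=; lra.
have : V t <= V T by apply: mono => //; lra.
rewrite /dl in VT; lra.
Qed.

(** Passes from estimates on squared 2-norms to the topological limit, which is expressed with the
    max norm. *)
Lemma cvg0_norm2 n (f : R -> 'cV[R]_n) (w : R -> R) (t0 K : R) :
  (forall t, t0 <= t -> dotv (f t) (f t) <= K * w t) ->
  w t @[t --> +oo] --> (0 : R) -> f t @[t --> +oo] --> (0 : 'cV[R]_n).
Proof.
move=> fw w0; apply/cvgr0Pnorm_lt => eps eps0.
have K0 : 0 < 1 + `|K| by rewrite ltr_pwDl.
have eK : 0 < eps ^+ 2 / (1 + `|K|) by rewrite divr_gt0 ?exprn_gt0.
move/cvgr0Pnorm_lt : w0 => /(_ _ eK) wK.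
near=> t.
have t0t : t0 <= t by near: t; apply: nbhs_pinfty_ge; exact: num_real.
have : `|w t| < eps ^+ 2 / (1 + `|K|) by near: t.
rewrite ltr_pdivlMr// => wt.
(* The max norm is checked entry by entry; the square of each entry is at most the squared
   2-norm. *)
rewrite [ltLHS]/Num.Def.normr/= mx_normrE bigmax_lt// => -[i j] _ /=.
rewrite (ord1 j) -ltr_sqr ?nnegrE// ?ltW// real_normK ?num_real//.
apply: le_lt_trans (sqr_entry_le_dotv _ _) _.
apply: le_lt_trans (fw _ t0t) _; apply: le_lt_trans wt.
apply: le_trans (ler_norm _) _; rewrite normrM mulrC ler_wpM2l//.
by rewrite lerDr.
Unshelve. all: by end_near. Qed.

End Derivatives.

(** * Quadratic comparison functions and bounded signals *)

Lemma comparison_fun_sqr (R : realType) (a : R) :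
  0 <= a -> comparison_fun (fun s => a * s ^+ 2).
Proof.
move=> a0; split=> [|s r s0 sr|]; last by rewrite expr0n mulr0.
  apply: continuous_subspaceT => x.
  by apply: cvgMr; apply: cvgM; exact: cvg_id.
by rewrite ler_wpM2l// ler_sqr ?nnegrE// (le_trans s0).
Qed.

Lemma Linfty_dotv (R : realType) (t0 C : R) k (f : R -> 'cV[R]_k) :
  (forall t, t0 <= t -> dotv (f t) (f t) <= C) -> Linfty t0 f.
Proof.
by move=> h; exists (Num.sqrt C) => t /h hC; exact: ler_wsqrtr.
Qed.

Lemma Linfty_ge0 (R : realType) (t0 : R) k (f : R -> 'cV[R]_k) :
  Linfty t0 f ->
  exists2 M, 0 <= M & forall t, t0 <= t -> norm2 (f t) <= M.
Proof.
move=> [M hM]; exists `|M| => // t /hM h.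
by apply: le_trans h _; rewrite ler_norm.
Qed.

(** * The Lyapunov function of the tuner and its derivative along solutions *)

Section Tuner.
Variables (R : realType) (n N : nat).
Implicit Types (A P Q : 'M[R]_n) (b : 'cV[R]_n) (thetas : 'cV[R]_N).
Implicit Types (phi vtheta theta : R -> 'cV[R]_N) (e : R -> 'cV[R]_n).

Lemma hot_VE (gamma : R) P (u : 'cV[R]_n) (x y : 'cV[R]_N) :
  hot_V gamma P (col_mx u (col_mx x y)) =
  gamma^-1 * dotv x x + gamma^-1 * dotv y y + quadform P u.
Proof. by rewrite /hot_V !(col_mxKu, col_mxKd) !sqr_norm2. Qed.

Lemma hot_V_posdef_decrescent (gamma : R) P : 0 < gamma -> sym_posdef P ->
  posdef_decrescent (@hot_V R n N gamma P).
Proof.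
move=> g0 pP; have ig0 : 0 < gamma^-1 by rewrite invr_gt0.
split.
  rewrite -[0](@vsubmxK _ n (N + N)) -[dsubmx _](@vsubmxK _ N N) hot_VE.
  by rewrite !linear0 /quadform /dotv !trmx0 !mul0mx mxE !mulr0 !addr0.
have [c c0 hc] := sym_posdef_coercive pP.
have [K K0 hK] := quadform_bounded P.
(* The squared norm of [z] is the sum over its three blocks. The minimum is a lower coefficient
   valid on each block, the sum [gamma^-1 + K] an upper one. *)
exists (fun s => Num.min gamma^-1 c * s ^+ 2), (fun s => (gamma^-1 + K) * s ^+ 2).
have m0 : 0 < Num.min gamma^-1 c by rewrite lt_min ig0 c0.
split; [exact/comparison_fun_sqr/ltW|by apply: comparison_fun_sqr; lra|].
move=> z z0; rewrite sqr_norm2; split; first by rewrite mulr_gt0// dotv_gt0.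
  rewrite -[z](@vsubmxK _ n (N + N)) -[dsubmx z](@vsubmxK _ N N) hot_VE.
  rewrite !dotv_col_mx !mulrDr addrC lerD//; first rewrite lerD//.
  - by rewrite ler_wpM2r ?dotv_ge0// ge_min lexx.
  - by rewrite ler_wpM2r ?dotv_ge0// ge_min lexx.
  - by apply: le_trans (hc _); rewrite ler_wpM2r ?dotv_ge0// ge_min lexx orbT.
rewrite -[z](@vsubmxK _ n (N + N)) -[dsubmx z](@vsubmxK _ N N) hot_VE.
rewrite !dotv_col_mx !mulrDr addrC lerD//; last rewrite lerD//.
- by apply: le_trans (ler_norm _) (le_trans (hK _) _); rewrite ler_wpM2r ?dotv_ge0//; lra.
- by rewrite ler_wpM2r ?dotv_ge0//; lra.
- by rewrite ler_wpM2r ?dotv_ge0//; lra.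
Qed.

(** The exact derivative of [hot_V] along solutions, with [u], [y], [f] standing for [e],
    [theta - vtheta], [phi]. *)
Definition hot_rate b P Q (gamma beta mu : R) (u : 'cV[R]_n) (y f : 'cV[R]_N) : R :=
  - (2 * beta / gamma * (1 + mu * dotv f f) * dotv y y)
  + 4 * dotv u (P *m b) * dotv y f - quadform Q u.

(** Of the [2 |u|^2] supplied by [Q], one copy enters the square and the other remains as [- |u|^2].
    The cross term is at most [4 |u| |Pb| |y| |f|], the double product of that square. *)
Lemma hot_rate_le b P Q (gamma beta mu : R) u y f : 0 < gamma -> 0 < beta ->
  design_condition b P Q gamma beta mu ->
  hot_rate b P Q gamma beta mu u y f <=
  - (2 * beta / gamma) * norm2 y ^+ 2 - norm2 u ^+ 2
  - (norm2 u - 2 * norm2 (P *m b) * norm2 y * norm2 f) ^+ 2.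
Proof.
move=> g0 b0 [hQ]; rewrite ler_pdivrMr// => hmu.
have {}hQ : 2 * norm2 u ^+ 2 <= quadform Q u.
  have := hQ u; rewrite /quadform mulmxBl mul_scalar_mx dotvDr dotvNr dotvZr subr_ge0.
  by rewrite sqr_norm2.
have hX : dotv u (P *m b) * dotv y f <=
    norm2 u * norm2 (P *m b) * (norm2 y * norm2 f).
  apply: le_trans (ler_norm _) _; rewrite normrM.
  by rewrite ler_pM// CauchySchwarz.
have hm : 4 * norm2 (P *m b) ^+ 2 <= 2 * beta / gamma * mu.
  by rewrite mulrAC ler_pdivlMr//; lra.
(* With this product available, the final inequality is a linear combination of known ones in the
   expanded monomials. *)
have : 4 * norm2 (P *m b) ^+ 2 * (norm2 f ^+ 2 * norm2 y ^+ 2) <=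
    2 * beta / gamma * mu * (norm2 f ^+ 2 * norm2 y ^+ 2).
  by rewrite ler_wpM2r// mulr_ge0 ?sqr_ge0.
by rewrite /hot_rate -!sqr_norm2; nra.
Qed.

(** Write [x = vtheta - thetas], [y = theta - vtheta], [r = e.Pb]. The three squares contribute the
    cross terms [- 2 r (x.phi)], [2 r (y.phi)] and [2 r ((x + y).phi)], whose sum is
    [4 r (y.phi)]. *)
Lemma is_derive_hot_V A b P Q (gamma beta mu : R) thetas phi (t0 : R)
    e vtheta theta :
  0 < gamma -> P^T = P -> A^T *m P + P *m A = - Q ->
  hot_solution A b P gamma beta mu thetas phi t0 e vtheta theta ->
  forall t, t0 <= t ->
  is_derive t (1 : R) (hot_V gamma P \o error_state thetas e vtheta theta)
    (hot_rate b P Q gamma beta mu (e t) (theta t - vtheta t) (phi t)).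
Proof.
move=> g0 sP lyap sol t t0t; have [de dx dth] := sol t t0t.
have dP := is_derive_mulmxl P de.
have dx' : is_derive t (1 : R) (fun s => vtheta s - thetas)
    (- (gamma * dotv (e t) (P *m b)) *: phi t).
  by apply: is_derive_eq (is_deriveB dx (is_derive_cst thetas t 1)) _; rewrite subr0.
have dy := is_deriveB dth dx.
have -> : hot_V gamma P \o error_state thetas e vtheta theta =
    (gamma^-1 *: (fun s => dotv (vtheta s - thetas) (vtheta s - thetas)))
    + (gamma^-1 *: (fun s => dotv ((theta - vtheta) s) ((theta - vtheta) s)))
    + (fun s => dotv (e s) (P *m e s)).
  by apply/funext => s; rewrite /= hot_VE.
apply: is_derive_eq (is_deriveD (is_deriveD
  (is_deriveZ gamma^-1 (is_derive_dotv dx' dx'))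
  (is_deriveZ gamma^-1 (is_derive_dotv dy dy))) (is_derive_dotv de dP)) _.
have -> : (theta - vtheta) t = theta t - vtheta t by [].
have lyap_e : dotv (A *m e t) (P *m e t) + dotv (e t) (P *m (A *m e t)) =
    - quadform Q (e t).
  rewrite dotv_mulmxl -dotvDr !mulmxA -mulmxDl lyap mulNmx.
  exact: dotvNr.
(* Splitting the parameter error into lag plus [vtheta] error exposes the cancellation to
   [field]. *)
have -> : theta t - thetas = (theta t - vtheta t) + (vtheta t - thetas).
  by rewrite addrA subrK.
move: (theta t - vtheta t) (vtheta t - thetas) => y x.
rewrite mulmxDr -!scalemxAr !(dotvDl, dotvDr, dotvNl, dotvNr, dotvZl, dotvZr).
rewrite (quadform_sym b (e t) sP) (dotvC (phi t) y) (dotvC (phi t) x).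
rewrite (canRL (addrK _) lyap_e) /hot_rate /normalizer /GRing.scale/=.
by field; rewrite gt_eqF.
Qed.

(** Provides the rate bound for the Barbalat argument on [|e|^2]: its derivative is
    [2 (e.Ae + s (e.b))], where [s] is the product of the parameter error with [phi]. *)
Lemma error_rate_bounded A b thetas phi (t0 : R) e vtheta theta :
  (forall t : R, t0 <= t -> is_derive t (1 : R) e
    (A *m e t + dotv (theta t - thetas) (phi t) *: b)) ->
  Linfty t0 e -> Linfty t0 (fun t => vtheta t - thetas) ->
  Linfty t0 (fun t => theta t - vtheta t) -> Linfty t0 phi ->
  exists (dw : R -> R) (L : R), forall t : R, t0 <= t ->
    is_derive t (1 : R) (fun s => dotv (e s) (e s)) (dw t) /\ `|dw t| <= L.
Proof.
move=> de /Linfty_ge0[E E0 hE] /Linfty_ge0[X X0 hX] /Linfty_ge0[Y Y0 hY].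
move=> /Linfty_ge0[F F0 hF]; have [K K0 hK] := quadform_bounded A.
pose s t := dotv (theta t - thetas) (phi t).
exists (fun t => 2 * (quadform A (e t) + s t * dotv (e t) b)).
(* [E], [X], [Y], [F] bound [e], [vtheta - thetas], [theta - vtheta] and [phi]; hence
   [|s| <= Y F + X F]. *)
exists (2 * (K * E ^+ 2 + (Y * F + X * F) * (E * norm2 b))) => t t0t; split.
  apply: is_derive_eq (is_derive_dotv (de t t0t) (de t t0t)) _.
  rewrite -/(s t) dotvC -mulr2n mulr_natl dotvDr dotvZr.
  by congr (_ *+ 2); congr (_ + _).
rewrite normrM ger0_norm// ler_pM2l// (le_trans (ler_normD _ _))// lerD//.
  apply: le_trans (hK _) _; rewrite ler_pM2l// -sqr_norm2.
  by rewrite ler_sqr ?nnegrE ?norm2_ge0 ?hE.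
rewrite normrM ler_pM//; last first.
  by apply: le_trans (CauchySchwarz _ _) _; rewrite ler_wpM2r ?norm2_ge0 ?hE.
rewrite /s -[theta t](subrK (vtheta t)) -addrA dotvDl.
apply: le_trans (ler_normD _ _) (lerD _ _);
  by apply: le_trans (CauchySchwarz _ _) _; rewrite ler_pM ?norm2_ge0 ?hX ?hY ?hF.
Qed.

(** The analogous rate bound for the lag [y = theta - vtheta], from
    [y' = - beta N_t y + gamma (e.Pb) phi]; bounded [phi] also bounds the normalizer. *)
Lemma lag_rate_bounded b P (gamma beta mu t0 : R) phi e vtheta theta :
  0 < gamma -> 0 < beta -> 0 < mu ->
  (forall t : R, t0 <= t -> is_derive t (1 : R) vtheta
    (- (gamma * dotv (e t) (P *m b)) *: phi t)) ->
  (forall t : R, t0 <= t -> is_derive t (1 : R) theta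
    (- (beta * normalizer mu phi t) *: (theta t - vtheta t))) ->
  Linfty t0 e -> Linfty t0 (fun t => theta t - vtheta t) -> Linfty t0 phi ->
  exists (dw : R -> R) (L : R), forall t : R, t0 <= t ->
    is_derive t (1 : R)
      (fun s => dotv (theta s - vtheta s) (theta s - vtheta s)) (dw t) /\
    `|dw t| <= L.
Proof.
move=> g0 b0 m0 dx dth /Linfty_ge0[E E0 hE] /Linfty_ge0[Y Y0 hY].
move=> /Linfty_ge0[F F0 hF].
pose y t := theta t - vtheta t; pose r t := dotv (e t) (P *m b).
exists (fun t => 2 * (gamma * r t * dotv (y t) (phi t)
  - beta * normalizer mu phi t * dotv (y t) (y t))).
exists (2 * (gamma * (E * norm2 (P *m b)) * (Y * F)
  + beta * (1 + mu * F ^+ 2) * Y ^+ 2)) => t t0t; split.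
  have dy := is_deriveB (dth t t0t) (dx t t0t).
  apply: is_derive_eq (is_derive_dotv dy dy) _.
  rewrite -/(r t) dotvC -mulr2n mulr_natl.
  have -> : (theta - vtheta) t = y t by [].
  by rewrite -/(y t) dotvDr dotvNr !dotvZr addrC !mulNr opprK.
have sqrM k (f : R -> 'cV[R]_k) M : 0 <= M -> norm2 (f t) <= M ->
    dotv (f t) (f t) <= M ^+ 2.
  by move=> M0 fM; rewrite -sqr_norm2 ler_sqr ?nnegrE ?norm2_ge0.
rewrite normrM ger0_norm// ler_pM2l// (le_trans (ler_normB _ _))// lerD//.
  rewrite normrM ler_pM//.
    rewrite normrM (gtr0_norm g0) ler_pM2l// (le_trans (CauchySchwarz _ _))//.
    by rewrite ler_wpM2r ?norm2_ge0 ?hE.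
  by rewrite (le_trans (CauchySchwarz _ _))// ler_pM ?norm2_ge0 ?hY ?hF.
have N0 : 0 <= normalizer mu phi t.
  by rewrite addr_ge0// mulr_ge0 ?dotv_ge0// ltW.
rewrite ger0_norm ?mulr_ge0 ?dotv_ge0 ?(ltW b0)//.
rewrite ler_pM ?dotv_ge0 ?sqrM ?hY ?mulr_ge0 ?(ltW b0)//.
by rewrite ler_pM2l// lerD2l ler_pM2l// sqrM ?hF.
Qed.
End Tuner.

(** * Assembly: Lyapunov property, boundedness and limits *)

Theorem theorem2 (R : realType) (n N : nat)
  (A : 'M[R]_n) (b : 'cV[R]_n) (Q P : 'M[R]_n)
  (gamma beta mu : R) (thetas : 'cV[R]_N) (t0 : R) (phi : R -> 'cV[R]_N)
  (A_stable : stable_mx A)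
  (Q_posdef : sym_posdef Q)
  (P_posdef : sym_posdef P)
  (P_lyap : A^T *m P + P *m A = - Q)
  (gamma_gt0 : 0 < gamma) (beta_gt0 : 0 < beta) (mu_gt0 : 0 < mu)
  (tuned : design_condition b P Q gamma beta mu) :
  lyapunov_function t0
    (error_trajectories A b P gamma beta mu thetas phi t0)
    (@hot_V R n N gamma P) /\
  forall (e : R -> 'cV[R]_n) (vtheta theta : R -> 'cV[R]_N),
  hot_solution A b P gamma beta mu thetas phi t0 e vtheta theta ->
  let V := fun t => hot_V gamma P (error_state thetas e vtheta theta t) in
  [/\ forall t, t0 <= t ->
        let B := - (2 * beta / gamma) * norm2 (theta t - vtheta t) ^+ 2
                 - norm2 (e t) ^+ 2
                 - (norm2 (e t) - 2 * norm2 (P *m b)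
                     * norm2 (theta t - vtheta t) * norm2 (phi t)) ^+ 2 in
        [/\ derivable V t 1, derive1 V t <= B & B <= 0],
      [/\ Linfty t0 e,
          Linfty t0 (fun t => vtheta t - thetas)
        & Linfty t0 (fun t => theta t - vtheta t)],
      Linfty t0 phi -> e t @[t --> +oo] --> (0 : 'cV[R]_n)
    & Linfty t0 phi ->
      (forall t, t0 <= t -> derivable phi t 1) -> Linfty t0 (derive1 phi) ->
      [/\ theta t - vtheta t @[t --> +oo] --> (0 : 'cV[R]_N),
          derive1 vtheta t @[t --> +oo] --> (0 : 'cV[R]_N)
        & derive1 (fun s => theta s - thetas) t @[t --> +oo] --> (0 : 'cV[R]_N)]].
Proof.
have [sP pP] := P_posdef.
have Bneg (y x : R) (D : R) : - (2 * beta / gamma) * y ^+ 2 - x ^+ 2 - D ^+ 2 <= 0.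
  have : 0 <= 2 * beta / gamma * y ^+ 2.
    by rewrite mulr_ge0 ?sqr_ge0// divr_ge0 ?mulr_ge0 ?ltW.
  by have := sqr_ge0 x; have := sqr_ge0 D; lra.
split.
  split; first exact: hot_V_posdef_decrescent.
  move=> _ [e [vtheta [theta [sol ->]]]] t t0t.
  have dV := is_derive_hot_V gamma_gt0 sP P_lyap sol t0t.
  split; first by case: dV.
  rewrite derive1E derive_val; apply: le_trans (Bneg _ _ _).
  exact: hot_rate_le.
move=> e vtheta theta sol V.
have dV t : t0 <= t -> is_derive t (1 : R) V
    (hot_rate b P Q gamma beta mu (e t) (theta t - vtheta t) (phi t)).
  exact: is_derive_hot_V sol t.
have dVle t : t0 <= t -> _ := fun _ => hot_rate_le (e t) (theta t - vtheta t)
  (phi t) gamma_gt0 beta_gt0 tuned.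
have dV0 t : t0 <= t ->
    hot_rate b P Q gamma beta mu (e t) (theta t - vtheta t) (phi t) <= 0.
  by move=> /dVle h; apply: le_trans h _; exact: Bneg.
have [c c0 hc] := sym_posdef_coercive P_posdef.
have VE t : V t = gamma^-1 * dotv (vtheta t - thetas) (vtheta t - thetas)
  + gamma^-1 * dotv (theta t - vtheta t) (theta t - vtheta t)
  + quadform P (e t) by rewrite /V hot_VE.
have ig0 : 0 < gamma^-1 by rewrite invr_gt0.
have ge0g k (v : 'cV[R]_k) : 0 <= gamma^-1 * dotv v v.
  by rewrite mulr_ge0 ?dotv_ge0 ?ltW.
have ge0P t : 0 <= quadform P (e t).
  by apply: le_trans (hc _); rewrite mulr_ge0 ?dotv_ge0 ?ltW.
have V0 t : 0 <= V t by rewrite VE !addr_ge0.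
have VV t : t0 <= t -> V t <= V t0 by apply: (derive_le0_nincr dV dV0).
(* [V] is a sum of three nonnegative terms and stays below [V t0], so each term does; coercivity of
   [P] turns this into a bound on [e]. *)
have eb : Linfty t0 e.
  apply: (@Linfty_dotv _ _ (V t0 / c)) => t t0t; rewrite ler_pdivlMr// mulrC.
  apply: le_trans (hc _) (le_trans _ (VV t t0t)).
  by rewrite VE lerDr addr_ge0.
have xb : Linfty t0 (fun t => vtheta t - thetas).
  apply: (@Linfty_dotv _ _ (V t0 * gamma)) => t t0t.
  rewrite -ler_pdivrMr// mulrC; apply: le_trans _ (VV t t0t).
  by rewrite VE -addrA lerDl addr_ge0.
have yb : Linfty t0 (fun t => theta t - vtheta t).
  apply: (@Linfty_dotv _ _ (V t0 * gamma)) => t t0t.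
  rewrite -ler_pdivrMr// mulrC; apply: le_trans _ (VV t t0t).
  by rewrite VE addrAC lerDr addr_ge0.
have de t (t0t : t0 <= t) := let: And3 h _ _ := sol t t0t in h.
have dx t (t0t : t0 <= t) := let: And3 _ h _ := sol t t0t in h.
have dth t (t0t : t0 <= t) := let: And3 _ _ h := sol t t0t in h.
have bg0 : 0 < 2 * beta / gamma by rewrite divr_gt0 ?mulr_gt0.
(* Only [- |e|^2] is kept from the bound on the derivative, so the dissipation constant is 1. *)
have ee0 : Linfty t0 phi -> dotv (e t) (e t) @[t --> +oo] --> (0 : R).
  move=> phib; have [dw [L hw]] := error_rate_bounded de eb xb yb phib.
  apply: (@dissipation_cvg0 _ V _ _ dw t0 1 L ltr01 dV) => t t0t //.
  - by case: (hw t t0t).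
  - exact: dotv_ge0.
  - apply: le_trans (dVle t t0t) _; rewrite !sqr_norm2 mul1r.
    set D := (norm2 _ - _); have := sqr_ge0 D.
    by have := mulr_ge0 (ltW bg0) (dotv_ge0 (theta t - vtheta t)); lra.
  - by case: (hw t t0t).
(* Here the lag term of the bound is kept, with constant [2 * beta / gamma]. *)
have yy0 : Linfty t0 phi -> dotv (theta t - vtheta t) (theta t - vtheta t)
    @[t --> +oo] --> (0 : R).
  move=> phib.
  have [dw [L hw]] :=
    lag_rate_bounded gamma_gt0 beta_gt0 mu_gt0 dx dth eb yb phib.
  apply: (@dissipation_cvg0 _ V _ _ dw t0 _ L bg0 dV) => t t0t //.
  - by case: (hw t t0t).
  - exact: dotv_ge0.
  - apply: le_trans (dVle t t0t) _; rewrite !sqr_norm2.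
    set D := (norm2 _ - _); have := sqr_ge0 D.
    by have := dotv_ge0 (e t); lra.
  - by case: (hw t t0t).
split=> //.
- move=> t t0t B; have dVt := dV t t0t; split; first by case: dVt.
    by rewrite derive1E derive_val; exact: dVle.
  exact: Bneg.
- by move=> /ee0; apply: (@cvg0_norm2 _ _ _ _ t0 1) => t _; rewrite mul1r.
move=> phib _ _; have [F F0 hF] := Linfty_ge0 phib.
have hFF t : t0 <= t -> dotv (phi t) (phi t) <= F ^+ 2.
  by move=> /hF ?; rewrite -sqr_norm2 ler_sqr ?nnegrE ?norm2_ge0.
split.
- by apply: (@cvg0_norm2 _ _ _ _ t0 1) (yy0 phib) => t _; rewrite mul1r.
(* By Cauchy-Schwarz, [(gamma (e.Pb))^2 |phi|^2 <= gamma^2 |Pb|^2 F^2 |e|^2]. *)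
- apply: (@cvg0_norm2 _ _ _ _ t0
    (gamma ^+ 2 * norm2 (P *m b) ^+ 2 * F ^+ 2)) (ee0 phib) => t t0t.
  have dxt := dx t t0t; rewrite derive1E derive_val dotvZl dotvZr mulrA mulrNN.
  rewrite -expr2 exprMn [leRHS]mulrAC ler_pM ?dotv_ge0//.
  + exact: mulr_ge0 (sqr_ge0 _) (sqr_ge0 _).
  + rewrite -[leRHS]mulrA ler_wpM2l ?sqr_ge0// [leRHS]mulrC -sqr_norm2 -exprMn.
    rewrite -real_normK ?num_real// ler_sqr ?nnegrE ?mulr_ge0 ?norm2_ge0//.
    exact: CauchySchwarz.
  + exact: hFF.
(* As [thetas] is constant, the derivative is that of [theta], namely [- beta N_t] times the lag,
   with [N_t <= 1 + mu F^2]. *)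
- apply: (@cvg0_norm2 _ _ _ _ t0
    ((beta * (1 + mu * F ^+ 2)) ^+ 2)) (yy0 phib) => t t0t.
  have dtht := dth t t0t.
  have dtht' := is_deriveB dtht (is_derive_cst thetas t 1).
  have -> : (fun s => theta s - thetas)^`()%classic t =
      - (beta * normalizer mu phi t) *: (theta t - vtheta t).
    by rewrite derive1E; case: dtht' => _ ->; rewrite subr0.
  rewrite dotvZl dotvZr mulrA mulrNN -expr2 ler_wpM2r ?dotv_ge0//.
  have N0 : 0 <= normalizer mu phi t.
    by rewrite addr_ge0// mulr_ge0 ?dotv_ge0// ltW.
  have NF : normalizer mu phi t <= 1 + mu * F ^+ 2.
    by rewrite lerD2l ler_pM2l// hFF.
  have NF0 := le_trans N0 NF.
  by rewrite ler_sqr ?nnegrE ?mulr_ge0 ?(ltW beta_gt0)// ler_pM2l.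
Qed.
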